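(* Let $(X_n)_{n\in\mathbb{N}}$ be a Markov chain on a finite state space $S$ with transition probability matrix $P$ whose associated graph $G=(S,E)$ is (weakly) connected. Then the chain has multistable states if and only if $G$ has at least two maximal communicating classes.
   Context: Markov chains are time-homogeneous; $p(i,j)$ are the entries of $P$. The associated graph $G=(S,E)$ has $(i,j)\in E$ iff $p(i,j)>0$; it is weakly connected if its underlying undirected graph is connected. Write $i\sim j$ if there are directed paths of length $\ge 1$ in $G$ from $i$ to $j$ and from $j$ to $i$; let $V_c=\{i\in S:i\sim j \text{ for some } j\in S\}$; the communicating classes of $G$ are the sets $[i]=\{j\in S: j\sim i\}$, $i\in V_c$. They are partially ordered by $C_\mu\preceq C_\nu$ iff there is a path in $G$ from some vertex of $C_\mu$ to some vertex of $C_\nu$; ''maximal'' means maximal with respect to $\preceq$. Let $C$ be the union of all maximal communicating classes and $\tau_C=\inf\{n\ge1:X_n\in C\}$. A state $i\in S$ is multistable if there are maximal communicating classes $C_1\ne C_2$ such that $p_\nu:=\mathbb{P}\{X_{\tau_C}\in C_\nu\mid X_0=i\}>0$ for $\nu=1,2$. *)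

(* Defs.v *)
From HB Require Import structures.
From mathcomp Require Import all_boot all_order all_algebra.
From mathcomp Require Import all_classical all_reals all_analysis.

Set Implicit Arguments.
Unset Strict Implicit.
Unset Printing Implicit Defensive.

Import Order.TTheory GRing.Theory Num.Theory.

Local Open Scope ring_scope.

Section Graph.
Variables (S : finType) (e : rel S).

Definition weakly_connected : Prop :=
  forall i j, connect (fun x y => e x y || e y x) i j.

(* [connect] also allows the empty path, so a directed path of length >= 1 is
   a first edge followed by a [connect]. *)
Definition dipath1 (i j : S) : bool := [exists k, e i k && connect e k j].

Definition communicate (i j : S) : bool := dipath1 i j && dipath1 j i.

Definition communicating_vertices : {set S} :=
  [set i | [exists j, communicate i j]].

Definition communicating_class (i : S) : {set S} := [set j | communicate j i].

Definition communicating_classes : {set {set S}} :=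
  [set communicating_class i | i in communicating_vertices].

Definition class_le (A B : {set S}) : bool :=
  [exists i in A, [exists j in B, connect e i j]].

Definition maximal_classes : {set {set S}} :=
  [set A in communicating_classes |
    [forall B in communicating_classes, class_le A B ==> (B == A)]].

End Graph.

Local Open Scope classical_set_scope.

Definition stochastic (R : realType) (S : finType) (P : S -> S -> R) : Prop :=
  (forall i j, 0 <= P i j) /\ (forall i, \sum_j P i j = 1).

Definition graph_of (R : realType) (S : finType) (P : S -> S -> R) : rel S :=
  fun i j => 0 < P i j.

Section MarkovChain.
Variables (d : measure_display) (T : measurableType d) (R : realType).
Variables (S : finType) (P : S -> S -> R).
Variable X : nat -> T -> S.

(* The conditional probability of [A] given [B]; it is only used when [B] has
   positive probability. *)
Definition cond_prob (Pr : probability T R) (A B : set T) : R :=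
  fine (Pr (A `&` B)) / fine (Pr B).

(* Under [Pr], [X] is a time-homogeneous Markov chain with transition
   probabilities [P]; its initial distribution is arbitrary. *)
Definition markov_chain (Pr : probability T R) : Prop :=
  (forall n (A : set S), measurable (X n @^-1` A)) /\
  (forall n (x : nat -> S) (y : S),
     let past := [set w | forall k, (k <= n)%N -> X k w = x k] in
     (0 < Pr past)%E ->
     cond_prob Pr [set w | X n.+1 w = y] past = P (x n) y).

(* inf {n >= 1 : X_n \in C}, equal to +oo when C is never visited. *)
Definition hitting_time (C : {set S}) (w : T) : \bar R :=
  ereal_inf [set (n%:R)%:E | n in [set n : nat | (1 <= n)%N /\ X n w \in C]].

(* The event that [hitting_time C] is finite and that [X] is in [A] at that
   time. *)
Definition hits_in (C A : {set S}) : set T :=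
  [set w | exists n : nat, hitting_time C w = (n%:R)%:E /\ X n w \in A].

Definition multistable (Pr : probability T R) (i : S) : Prop :=
  let M := maximal_classes (graph_of P) in
  exists C1 C2 : {set S},
    [/\ C1 \in M, C2 \in M, C1 != C2,
        0 < cond_prob Pr (hits_in (finset.cover M) C1) [set w | X 0%N w = i] &
        0 < cond_prob Pr (hits_in (finset.cover M) C2) [set w | X 0%N w = i]].

End MarkovChain.

(* Main.v *)
(* Since every state has a successor, each state leads to a terminal state
   (one that is reachable from everything it reaches), and the maximal classes
   are exactly the reachable sets of terminal states.  If A and B are distinct
   maximal classes, an undirected walk from A to B contains two neighbours u, v
   such that u leads to A and v does not; then u -> v, and u leads both to A and
   to some other maximal class.  Any path from u to a maximal class is in that
   class when it first enters the union of the maximal classes, and a finite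
   path in the graph has positive probability. *)

Require Import Defs.
From HB Require Import structures.
From mathcomp Require Import all_boot all_order all_algebra.
From mathcomp Require Import all_classical all_reals all_analysis.

Set Implicit Arguments.
Unset Strict Implicit.
Unset Printing Implicit Defensive.

Import Order.TTheory GRing.Theory Num.Theory.

(** * Graph theory: terminal states and maximal communicating classes *)

Section TerminalStates.
Variables (S : finType) (e : rel S).
Implicit Types (i k u v : S) (A : {set S}).

Definition terminal k : bool := [forall j, connect e k j ==> connect e j k].

Definition reachable k : {set S} := [set j | connect e k j].

Lemma terminalP k :
  reflect (forall j, connect e k j -> connect e j k) (terminal k).
Proof.
apply: (iffP forallP) => [h j|h j]; first exact/implyP/h.
exact/implyP/h.
Qed.

Lemma dipath1_connect i j : dipath1 e i j -> connect e i j.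
Proof.
by case/existsP=> k /andP[eik kj]; apply: connect_trans kj; apply: connect1.
Qed.

(** From [j] there is a way back to both [k] and [k'], so each of them leads to the other. *)
Lemma reachable_eq k k' j : terminal k -> terminal k' ->
  j \in reachable k -> j \in reachable k' -> reachable k = reachable k'.
Proof.
rewrite !inE => /terminalP tk /terminalP tk' kj k'j; apply/setP=> x.
rewrite !inE; apply/idP/idP.
  exact/connect_trans/(connect_trans k'j)/tk.
exact/connect_trans/(connect_trans kj)/tk'.
Qed.

(** Among the states that [i] leads to, take one with the fewest reachable states: moving on from it
    cannot shrink the reachable set, so it stays reachable. *)
Lemma exists_terminal i : exists2 k, connect e i k & terminal k.
Proof.
have [k ik kmin] := arg_minnP (fun k => #|reachable k|) (connect0 e i).
exists k => //; apply/terminalP => j kj.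
have sub : reachable j \subset reachable k.
  by apply/fintype.subsetP => x; rewrite !inE; apply: connect_trans.
have : reachable j == reachable k.
  by rewrite eqEcard sub kmin // (connect_trans ik kj).
by move=> /eqP /setP /(_ k); rewrite !inE connect0.
Qed.

(** A path from [u] to [v] is cut at its first vertex after [u] lying in [C]. Time 0 is exempt, as
    in the hitting time, and [u != v] forces at least one step. The remaining path to [v] is kept to
    identify the class entered. *)
Lemma first_entry (C : {set S}) u v : connect e u v -> u != v -> v \in C ->
  exists (x : nat -> S) (n : nat),
    [/\ x 0%N = u, forall j : nat, (j <= n)%N -> e (x j) (x j.+1),
        forall j : nat, (1 <= j <= n)%N -> x j \notin C, x n.+1 \in C &
        connect e (x n.+1) v].
Proof.
case/connectP=> p; elim: p u => [|y q IH] u /=.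
  by move=> _ ->; rewrite eqxx.
case/andP=> euy yq vE _ vC; case: (boolP (y \in C)) => [yC|yNC].
  exists (fun n => if n is 0%N then u else y), 0%N; split=> //.
  - by case.
  - by case.
  by apply/connectP; exists q.
have yv : y != v by apply: contraNneq yNC => ->.
have [x [n [x0 xe xN xC xv]]] := IH y yq vE yv vC.
exists (fun n => if n is m.+1 then x m else u), n.+1; split=> //.
  by case=> [|j]; [rewrite x0|exact: xe].
by case=> [|[|j]] //; [rewrite x0|move=> jn; apply: xN].
Qed.

Hypothesis e_succ : forall i, exists j, e i j.

Lemma terminal_class k : terminal k ->
  communicating_class e k = reachable k.
Proof.
move=> /terminalP tk; apply/setP=> j; rewrite !inE; apply/idP/idP.
  by case/andP=> _ /dipath1_connect.
(* A first edge out of [a] makes the path nonempty; its endpoint leads back to [k] by terminality,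
   and from there to [b]. *)
have dip a b : connect e k a -> connect e k b -> dipath1 e a b.
  move=> ka kb; have [c eac] := e_succ a.
  apply/existsP; exists c; rewrite eac /=; apply: connect_trans kb.
  exact/tk/(connect_trans ka)/connect1.
by move=> kj; rewrite /communicate !dip ?connect0.
Qed.

Lemma terminal_in_classes k : terminal k ->
  reachable k \in communicating_classes e.
Proof.
move=> tk; rewrite -terminal_class //; apply: imset_f; rewrite inE.
apply/existsP; exists k.
have : k \in communicating_class e k by rewrite terminal_class // inE connect0.
by rewrite inE.
Qed.

(** A maximal class leads to a terminal state, whose reachable set is a class above it and hence
    equal to it. Conversely, a class above [reachable k] has a representative that [k] reaches,
    which is therefore terminal too. *)
Lemma maximal_classP A :
  reflect (exists2 k, terminal k & A = reachable k)
          (A \in maximal_classes e).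
Proof.
apply: (iffP idP) => [|[k tk ->]].
  rewrite inE => /andP[/imsetP[a]]; rewrite inE => /existsP[b /andP[ab ba] AE].
  move=> /forallP Amax; have [k ak tk] := exists_terminal a; exists k => //.
  have := Amax (reachable k); rewrite terminal_in_classes //= => /implyP H.
  apply/esym/eqP/H/existsP; exists a; apply/andP; split.
    have dip c c' : dipath1 e a c -> connect e c c' -> dipath1 e a c'.
      case/existsP=> y /andP[ay yc] cc'; apply/existsP; exists y.
      by rewrite ay (connect_trans yc cc').
    have aa : dipath1 e a a by apply: dip ab (dipath1_connect ba).
    by rewrite AE inE /communicate aa.
  by apply/existsP; exists k; rewrite inE connect0.
rewrite inE terminal_in_classes //=; apply/forallP => B; apply/implyP.
case/imsetP=> b _ ->; apply/implyP => /existsP[i /andP[]]; rewrite inE => ki.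
case/existsP=> j /andP[]; rewrite inE => /andP[jb bj] ij.
have kb : connect e k b.
  exact: connect_trans ki (connect_trans ij (dipath1_connect jb)).
have tb : terminal b.
  move/terminalP: tk => tk; apply/terminalP => c bc.
  exact: connect_trans (tk _ (connect_trans kb bc)) kb.
by rewrite terminal_class //; apply/eqP/(@reachable_eq _ _ b); rewrite // inE.
Qed.

Lemma connect_crossing (r : rel S) (Q : pred S) u v :
  connect r u v -> Q u -> ~~ Q v -> exists a b, [/\ r a b, Q a & ~~ Q b].
Proof.
case/connectP=> p; elim: p u => [|y q IH] u /=; first by move=> _ -> ->.
case/andP=> uy yq vE Qu NQv; case: (boolP (Q y)) => Qy; first exact: (IH y).
by exists u, y.
Qed.

Lemma leads_to_two_classes : weakly_connected e ->
  (2 <= #|maximal_classes e|)%N ->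
  exists u k1 k2, [/\ terminal k1, terminal k2, reachable k1 != reachable k2,
    connect e u k1 & connect e u k2].
Proof.
move=> wc /card_gt1P[A [B [/maximal_classP[k tk ->] /maximal_classP[l tl ->]]]].
move=> klN; have /(_ (connect0 e k))[|a [b [ab ak bk]]] :=
    @connect_crossing _ (fun i => connect e i k) _ _ (wc k l).
  apply: contra_neqN klN => lk.
  by apply: (@reachable_eq _ _ k); rewrite // inE ?connect0.
(* The crossing edge cannot point from [b] to [a], since [b] would then lead to [k] through [a]. *)
have eab : e a b.
  case/orP: ab => // eba.
  by case/negP: bk; apply: connect_trans ak; apply: connect1.
have [k' bk' tk'] := exists_terminal b.
exists a, k, k'; split=> //; last exact/(connect_trans (connect1 eab)).
apply: contraNneq bk => /setP /(_ k); rewrite !inE connect0 => /esym.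
exact: connect_trans.
Qed.

Lemma first_entry_maximal u k : terminal k -> connect e u k ->
    u \notin reachable k ->
  exists (x : nat -> S) (n : nat),
    [/\ x 0%N = u, forall j : nat, (j <= n)%N -> e (x j) (x j.+1),
        forall j : nat, (1 <= j <= n)%N ->
          x j \notin finset.cover (maximal_classes e),
        x n.+1 \in finset.cover (maximal_classes e) &
        x n.+1 \in reachable k].
Proof.
move=> tk uk uNk.
have kM : reachable k \in maximal_classes e by apply/maximal_classP; exists k.
have kC : k \in finset.cover (maximal_classes e).
  by apply/bigcupP; exists (reachable k); rewrite // inE.
have neq : u != k by apply: contraNneq uNk => ->; rewrite inE.
have [x [n [x0 xe xN xC xk]]] := first_entry uk neq kC.
exists x, n; split=> //.
(* The class entered still leads to [k], so it contains [k] and must be [reachable k]. *)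
case/bigcupP: xC => _ /maximal_classP[l tl ->] xl.
rewrite (@reachable_eq k l k) // inE ?connect0 //.
by apply: connect_trans xk; rewrite inE in xl.
Qed.

End TerminalStates.

Local Open Scope classical_set_scope.
Local Open Scope ring_scope.

(** * Hitting times and measurability of hitting events *)

Section HittingTime.
Variables (d : measure_display) (T : measurableType d) (R : realType).
Variables (S : finType) (X : nat -> T -> S).
Implicit Types (C A : {set S}) (w : T).

Lemma hitting_time_first C w n :
  (1 <= n)%N -> X n w \in C -> (forall k, (1 <= k < n)%N -> X k w \notin C) ->
  hitting_time R X C w = (n%:R)%:E.
Proof.
move=> n1 nC nmin; apply/eqP; rewrite eq_le; apply/andP; split.
  by apply: ereal_inf_lbound; exists n.
apply: le_ereal_inf_tmp => _ [k [k1 kC] <-]; rewrite lee_fin ler_nat leqNgt.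
by apply: contraL kC => kn; apply: nmin; rewrite k1.
Qed.

Lemma hitting_timeP C w n :
  hitting_time R X C w = (n%:R)%:E <->
  [/\ (1 <= n)%N, X n w \in C &
      forall k, (1 <= k < n)%N -> X k w \notin C].
Proof.
split=> [hn|[n1 nC nmin]]; last exact: hitting_time_first.
have [ex|nex] := pselect (exists k, (1 <= k)%N && (X k w \in C)); last first.
  (* Without a visit the infimum over the empty set is [+oo], which is not a natural number. *)
  suff E : [set k : nat | (1 <= k)%N /\ X k w \in C] = set0.
    by move: hn; rewrite /hitting_time E image_set0 ereal_inf0.
  by apply/seteqP; split=> // k [k1 kC]; apply: nex; exists k; rewrite k1.
case: (ex_minnP ex) => m /andP[m1 mC] mmin.
have nC k : (1 <= k < m)%N -> X k w \notin C.
  move=> /andP[k1]; rewrite ltnNge; apply: contra => kC.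
  by apply: mmin; rewrite k1.
move: hn; rewrite (hitting_time_first m1 mC nC) => -[] /eqP.
by rewrite eqr_nat => /eqP <-.
Qed.

(** Splitting by the value of the hitting time gives a countable union of events about finitely many
    coordinates. *)
Lemma measurable_hits_in C A :
  (forall n (B : set S), measurable (X n @^-1` B)) ->
  measurable (hits_in R X C A).
Proof.
move=> mX.
have -> : hits_in R X C A = \bigcup_(n in [set n | (1 <= n)%N])
    (X n @^-1` [set s | s \in C :&: A] `&`
     \bigcap_(k in [set k | (1 <= k < n)%N]) X k @^-1` [set s | s \notin C]).
  apply/seteqP; split=> w.
    move=> [n [/hitting_timeP[n1 nC nmin] nA]]; exists n => //; split=> //=.
    by rewrite inE nC.
  move=> [n n1 [/= + nmin]]; rewrite inE => /andP[nC nA].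
  by exists n; split=> //; apply/hitting_timeP.
apply: bigcup_measurable => n _; apply: measurableI; first exact: mX.
by apply: bigcap_measurableType => k _; exact: mX.
Qed.

End HittingTime.

(** * Positive probability of finite paths *)

Section PathProbability.
Variables (d : measure_display) (T : measurableType d) (R : realType).
Variables (S : finType) (P : S -> S -> R) (X : nat -> T -> S).
Variable Pr : probability T R.
Hypothesis X_markov : markov_chain P X Pr.

Lemma path_prob_gt0 (x : nat -> S) n :
  (0 < Pr [set w | X 0%N w = x 0%N])%E ->
  (forall k, (k < n)%N -> 0 < P (x k) (x k.+1)) ->
  (0 < Pr [set w | forall k, (k <= n)%N -> X k w = x k])%E.
Proof.
move=> P0; elim: n => [|n IH] xP.
  congr (_ < Pr _)%E: P0; apply/seteqP; split=> w /=.
    by move=> X0 k; rewrite leqn0 => /eqP ->.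
  by apply.
have past_gt0 := IH (fun k kn => xP k (ltnW kn)).
have step := X_markov.2 n x (x n.+1) past_gt0.
have := xP n (ltnSn n); rewrite -step /cond_prob.
have -> : [set w | X n.+1 w = x n.+1] `&`
    [set w | forall k, (k <= n)%N -> X k w = x k] =
    [set w | forall k, (k <= n.+1)%N -> X k w = x k].
  apply/seteqP; split=> w /=.
    move=> [Xn Xk] k; rewrite leq_eqVlt => /predU1P[->//|].
    exact: Xk.
  by move=> Xk; split=> [|k kn]; apply: Xk => //; exact: leqW.
(* A null extended path would make the one-step conditional probability 0, although the transition
   has positive probability. *)
move=> h; rewrite lt0e measure_ge0 andbT; apply: contraTneq h => ->.
by rewrite mul0r ltxx.
Qed.

Lemma cond_prob_gt0 (A B E : set T) : measurable A -> measurable B ->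
  measurable E -> E `<=` A `&` B -> (0 < Pr E)%E -> 0 < cond_prob Pr A B.
Proof.
move=> mA mB mE EAB E0.
have AB0 : (0 < Pr (A `&` B))%E.
  by apply: (lt_le_trans E0); apply: le_measure; rewrite ?inE //; apply: measurableI.
have B0 : (0 < Pr B)%E.
  apply: (lt_le_trans AB0); apply: le_measure; rewrite ?inE //.
  exact: measurableI.
by apply: divr_gt0; apply: fine_gt0; rewrite ?AB0 ?B0 ltey_eq fin_num_measure //;
  apply: measurableI.
Qed.

Lemma cond_hits_in_gt0 (C A : {set S}) (x : nat -> S) n :
  (0 < Pr [set w | X 0%N w = x 0%N])%E ->
  (forall k, (k <= n)%N -> 0 < P (x k) (x k.+1)) ->
  (forall k, (1 <= k <= n)%N -> x k \notin C) ->
  x n.+1 \in C -> x n.+1 \in A ->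
  0 < cond_prob Pr (hits_in R X C A) [set w | X 0%N w = x 0%N].
Proof.
move=> x0 xP xN xC xA; have mX := X_markov.1.
apply: (cond_prob_gt0 _ _ _ _ (@path_prob_gt0 x n.+1 x0 xP)).
- exact: measurable_hits_in.
- exact: (mX 0%N [set x 0%N]).
- have -> : [set w | forall k, (k <= n.+1)%N -> X k w = x k] =
      \bigcap_(k in [set k | (k <= n.+1)%N]) X k @^-1` [set x k] by [].
  by apply: bigcap_measurableType => k _; exact: mX.
move=> w /= Xx; split; last exact: Xx.
exists n.+1; split; last by rewrite Xx.
apply: hitting_time_first; rewrite ?Xx // => k /andP[k1 kn].
by rewrite Xx ?xN ?k1 //; exact: ltnW.
Qed.

End PathProbability.

(* [Pr i] is a law of the chain that charges the initial state [i], so that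
   conditioning on X_0 = i makes sense under it.  [Pr i] may be the law of the
   chain started at [i]; a constant family is a single chain whose initial
   distribution charges every state. *)
Theorem fact18 (R : realType) (S : finType) (P : S -> S -> R)
    (d : measure_display) (T : measurableType d) (X : nat -> T -> S)
    (Pr : S -> probability T R)
    (P_stochastic : stochastic P)
    (X_markov : forall i, markov_chain P X (Pr i))
    (Pr_initial : forall i, (0 < Pr i [set w | X 0%N w = i])%E)
    (G_connected : weakly_connected (graph_of P)) :
  (exists i : S, multistable P X (Pr i) i) <->
  (2 <= #|maximal_classes (graph_of P)|)%N.
Proof.
(* A row without positive entries would sum to 0 instead of 1. *)
have succ i : exists j, graph_of P i j.
  apply/existsP; apply: contraT; rewrite negb_exists => /forallP noj.
  have := P_stochastic.2 i; rewrite big1 => [/esym/eqP|j _].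
    by rewrite oner_eq0.
  by apply/eqP; rewrite eq_le P_stochastic.1 andbT leNgt; exact: noj.
split=> [[i [C1 [C2 [C1M C2M C12 _ _]]]]|]; first by apply/card_gt1P; exists C1, C2.
move=> /(leads_to_two_classes succ G_connected)[u [k1 [k2 [t1 t2 k12 uk1 uk2]]]].
have hit k l : terminal (graph_of P) k -> terminal (graph_of P) l ->
    reachable (graph_of P) k != reachable (graph_of P) l ->
    connect (graph_of P) u k -> connect (graph_of P) u l ->
    0 < cond_prob (Pr u) (hits_in R X
      (finset.cover (maximal_classes (graph_of P))) (reachable (graph_of P) k))
      [set w | X 0%N w = u].
  move=> tk tl kl uk ul.
  (* Otherwise [k] would lead through [u] to [l], and the two reachable sets would share [l] and
     coincide. *)
  have uNk : u \notin reachable (graph_of P) k.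
    apply: contra_neqN kl; rewrite inE => ku.
    by apply: (@reachable_eq _ _ _ _ l); rewrite // inE ?connect0 //;
      exact: connect_trans ul.
  have [x [n [x0 xe xN xC xk]]] := first_entry_maximal succ tk uk uNk.
  have Pu : (0 < Pr u [set w | X 0%N w = x 0%N])%E by rewrite x0.
  by have := cond_hits_in_gt0 (X_markov u) Pu xe xN xC xk; rewrite x0.
exists u, (reachable (graph_of P) k1), (reachable (graph_of P) k2); split=> //.
- by apply/(maximal_classP succ); exists k1.
- by apply/(maximal_classP succ); exists k2.
- exact: hit t1 t2 k12 uk1 uk2.
- by apply: hit t2 t1 _ uk2 uk1; rewrite eq_sym.
Qed.
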